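(* Let $n \ge 2$, let $A \in \mathbb{R}^{m\times n}$ be a matrix with non-trivial null space, let $B \in \mathbb{R}^{p\times m}$ be any matrix, and set $C = BA$. Let $W \in \mathbb{R}^{n\times n}$ be the diagonal matrix with diagonal entries $w_i = \|C e_i\|_2$, $i=1,\dots,n$. Let $x^* \in \mathbb{R}^n$, let $\mathcal{J} = \operatorname{supp}(x^* )$, so that $x^* = \sum_{j\in\mathcal{J}} x_j^* e_j$, and assume that $$\operatorname{supp}(C^T C e_j) \cap \operatorname{supp}(C^T C e_k) = \emptyset \quad \text{for all } j,k \in \mathcal{J},\ j \neq k .$$ Assume also that $$C e_l \neq c\, C e_q \quad \text{for all } l, q \in \{1,\dots,n\} \text{ with } l \neq q \text{ and all } c \in \mathbb{R}.$$ Then $x^*$ is the unique solution of $$\min_{x \in \mathbb{R}^n} \|W x\|_1 \quad \text{subject to} \quad A x = A x^* .$$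
   Context: $e_1,\dots,e_n$ denote the standard Euclidean unit basis vectors of $\mathbb{R}^n$; $\|\cdot\|_1$ and $\|\cdot\|_2$ are the usual $\ell^1$- and Euclidean norms. For $v\in\mathbb{R}^n$, $\operatorname{supp}(v) = \{ i : v_i \neq 0\}$. *)

(* Defs.v *)
From mathcomp Require Import all_boot all_order all_algebra.
From mathcomp Require Import reals.
Set Implicit Arguments.
Unset Strict Implicit.
Unset Printing Implicit Defensive.
Import Order.TTheory GRing.Theory Num.Theory.
Local Open Scope ring_scope.

Definition l1norm (R : realType) (n : nat) (v : 'cV[R]_n) : R :=
  \sum_i `|v i 0|.

Definition l2norm (R : realType) (n : nat) (v : 'cV[R]_n) : R :=
  Num.sqrt (\sum_i v i 0 ^+ 2).

Definition supp (R : realType) (n : nat) (v : 'cV[R]_n) : {set 'I_n} :=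
  [set i | v i 0 != 0].

Definition unit_vec (R : realType) (n : nat) (i : 'I_n) : 'cV[R]_n :=
  delta_mx i 0.
Arguments unit_vec R {n} i.

Definition nontrivial_null_space (R : realType) (m n : nat)
    (A : 'M[R]_(m, n)) : Prop :=
  exists2 v : 'cV[R]_n, v != 0 & A *m v = 0.

Definition is_minimizer (R : realType) (T : Type) (f : T -> R)
    (feasible : T -> Prop) (x : T) : Prop :=
  feasible x /\ forall y, feasible y -> f x <= f y.

(* Main.v *)
(* Write c_i = C e_i and let y be the sum over j in J of sgn(x*_j) c_j / |c_j|.
   The support condition leaves at most one nonzero term in <c_i, y>, so
   <c_i, y> = sgn(x*_i) w_i on J, while strict Cauchy-Schwarz gives
   |<c_i, y>| < w_i off J.  As h = x - x* satisfies C h = 0, the vector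
   (<c_i, y>)_i is orthogonal to h, hence a dual certificate: x* is a minimizer
   and any other minimizer has h supported in J.  The support condition also
   makes the c_j, j in J, orthogonal, so that C h = 0 then forces h = 0. *)

Require Import Defs.
From mathcomp Require Import all_boot all_order all_algebra.
From mathcomp Require Import reals.
From mathcomp Require Import ring.
Set Implicit Arguments.
Unset Strict Implicit.
Unset Printing Implicit Defensive.
Import Order.TTheory GRing.Theory Num.Theory.
Local Open Scope ring_scope.

Definition dot (R : realType) (p : nat) (u v : 'cV[R]_p) : R :=
  \sum_k u k 0 * v k 0.

Lemma dot_gt0 (R : realType) (p : nat) (u : 'cV[R]_p) : u != 0 -> 0 < dot u u.
Proof.
move=> u_neq0.
have sq_ge0 k : true -> 0 <= u k 0 * u k 0 by rewrite -expr2 sqr_ge0.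
rewrite lt_def sumr_ge0 // andbT; apply: contraNneq u_neq0 => uu0.
apply/eqP/colP => k; rewrite mxE; apply/eqP.
by rewrite -sqrf_eq0 expr2 (psumr_eq0P sq_ge0 uu0).
Qed.

Lemma l2norm_sqr (R : realType) (p : nat) (u : 'cV[R]_p) :
  l2norm u ^+ 2 = dot u u.
Proof.
rewrite /l2norm sqr_sqrtr; first by apply: eq_bigr => k _; rewrite expr2.
by apply: sumr_ge0 => k _; rewrite sqr_ge0.
Qed.

Lemma l2norm_gt0 (R : realType) (p : nat) (u : 'cV[R]_p) :
  u != 0 -> 0 < l2norm u.
Proof.
move=> u_neq0; rewrite lt_def sqrtr_ge0 andbT -sqrf_eq0 l2norm_sqr.
by rewrite gt_eqF // dot_gt0.
Qed.

(** After squaring, the gap is the Gram determinant of [u] and [v]. Multiplied by [dot u u], it is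
    the squared norm of [dot u u *: v - dot v u *: u], which is nonzero because [v] is not a
    multiple of [u]. *)
Lemma cauchy_schwarz_strict (R : realType) (p : nat) (u v : 'cV[R]_p) :
  u != 0 -> (forall c : R, v <> c *: u) -> `|dot v u| < l2norm v * l2norm u.
Proof.
move=> u_neq0 v_nparallel.
have a_gt0 := dot_gt0 u_neq0.
rewrite -(@ltr_pXn2r _ 2) ?nnegrE ?mulr_ge0 ?sqrtr_ge0 //.
rewrite exprMn !l2norm_sqr real_normK ?num_real //.
have w_neq0 : dot u u *: v - dot v u *: u != 0.
  apply/eqP => /subr0_eq eq_w; apply: (v_nparallel (dot v u / dot u u)).
  by rewrite mulrC -scalerA -eq_w scalerA mulVf ?scale1r ?gt_eqF.
have := dot_gt0 w_neq0.
have -> : dot (dot u u *: v - dot v u *: u) (dot u u *: v - dot v u *: u)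
          = dot u u * (dot v v * dot u u - dot v u ^+ 2).
  have expand (a b : R) : dot (a *: v - b *: u) (a *: v - b *: u) =
      a ^+ 2 * dot v v - (2 * a * b) * dot v u + b ^+ 2 * dot u u.
    rewrite /dot !mulr_sumr -sumrB -big_split; apply: eq_bigr => k _ /=.
    rewrite !mxE; ring.
  rewrite expand; ring.
by rewrite pmulr_rgt0 // subr_gt0.
Qed.

(** Translates disjointness of supports into vanishing of inner products of columns of [C]. *)
Lemma gramE (R : realType) (p n : nat) (C : 'M[R]_(p, n)) (i j : 'I_n) :
  (C^T *m C *m unit_vec R j) i 0 = dot (C *m unit_vec R i) (C *m unit_vec R j).
Proof.
rewrite /unit_vec -!colE !mxE; apply: eq_bigr => k _; by rewrite !mxE.
Qed.

Lemma dot_mulmx (R : realType) (p n : nat) (C : 'M[R]_(p, n)) (h : 'cV[R]_n)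
    (u : 'cV[R]_p) :
  dot (C *m h) u = \sum_i dot (C *m unit_vec R i) u * h i 0.
Proof.
under [RHS]eq_bigr => i _ do rewrite mulr_suml.
rewrite exchange_big; apply: eq_bigr => k _; rewrite mxE mulr_suml.
by apply: eq_bigr => i _; rewrite /unit_vec -colE mxE mulrAC.
Qed.

Lemma l1norm_diag_mx (R : realType) (n : nat) (w : 'rV[R]_n) (x : 'cV[R]_n) :
  (forall i, 0 <= w 0 i) ->
  l1norm (diag_mx w *m x) = \sum_i w 0 i * `|x i 0|.
Proof.
move=> w_ge0; apply: eq_bigr => i _.
by rewrite mul_diag_mx mxE normrM ger0_norm.
Qed.

Lemma sum_single (V : nmodType) (I : finType) (P : pred I) (F : I -> V) (j : I) :
  P j -> (forall k, P k -> k != j -> F k = 0) -> \sum_(k | P k) F k = F j.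
Proof.
by move=> Pj F0; rewrite (bigD1 j) //= big1 ?addr0 // => k /andP[]; exact: F0.
Qed.

Section Certificate.
Variables (R : realType) (n : nat) (w s : 'I_n -> R) (x0 : 'cV[R]_n).
Hypothesis w_ge0 : forall i, 0 <= w i.
Hypothesis s_on : forall i, i \in supp x0 -> s i = Num.sg (x0 i 0) * w i.
Hypothesis s_off : forall i, i \notin supp x0 -> `|s i| < w i.

(** This is the subgradient inequality at [x0], one coordinate at a time. On the support the two
    [x0] terms cancel, since the absolute value is sign times entry; off it [x0 i 0] is zero and the
    bound on [s i] suffices. *)
Lemma certificate_le (x : 'cV[R]_n) (i : 'I_n) :
  w i * `|x0 i 0| + s i * (x i 0 - x0 i 0) <= w i * `|x i 0|.
Proof.
case: (boolP (i \in supp x0)) => [iJ|inJ].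
  rewrite s_on // mulrBr (normrEsg (x0 i 0)) [X in X <= _](_ : _ =
    w i * (Num.sg (x0 i 0) * x i 0)); last by ring.
  rewrite ler_wpM2l //; apply: le_trans (ler_norm _) _.
  by rewrite normrM normr_sg ler_piMl // lern1 leq_b1.
have /eqP -> : x0 i 0 == 0 by move: inJ; rewrite inE negbK.
rewrite normr0 mulr0 add0r subr0; apply: le_trans (ler_norm _) _.
by rewrite normrM ler_wpM2r // ltW // s_off.
Qed.

Lemma certificate_lt (x : 'cV[R]_n) (i : 'I_n) :
  i \notin supp x0 -> x i 0 != 0 ->
  w i * `|x0 i 0| + s i * (x i 0 - x0 i 0) < w i * `|x i 0|.
Proof.
move=> inJ xi_neq0.
have /eqP -> : x0 i 0 == 0 by move: inJ; rewrite inE negbK.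
rewrite normr0 mulr0 add0r subr0; apply: le_lt_trans (ler_norm _) _.
by rewrite normrM ltr_pM2r ?normr_gt0 // s_off.
Qed.

Lemma certificate_min (x : 'cV[R]_n) :
  \sum_i s i * (x i 0 - x0 i 0) = 0 ->
  \sum_i w i * `|x0 i 0| <= \sum_i w i * `|x i 0|.
Proof.
move=> s_orth; have -> : \sum_i w i * `|x0 i 0| =
    \sum_i (w i * `|x0 i 0| + s i * (x i 0 - x0 i 0)).
  by rewrite big_split /= s_orth addr0.
by apply: ler_sum => i _; apply: certificate_le.
Qed.

(** A single nonzero entry off the support makes its coordinate inequality strict, hence also the
    sum, against the assumed bound. *)
Lemma certificate_supp (x : 'cV[R]_n) :
  \sum_i s i * (x i 0 - x0 i 0) = 0 ->
  \sum_i w i * `|x i 0| <= \sum_i w i * `|x0 i 0| ->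
  forall i, i \notin supp x0 -> x i 0 = 0.
Proof.
move=> s_orth le_x i inJ; apply/eqP/negP => /negP xi_neq0.
have : \sum_i w i * `|x0 i 0| < \sum_i w i * `|x i 0|.
  have -> : \sum_i w i * `|x0 i 0| =
      \sum_i (w i * `|x0 i 0| + s i * (x i 0 - x0 i 0)).
    by rewrite big_split /= s_orth addr0.
  rewrite (bigD1 i) // [ltRHS](bigD1 i) //=.
  apply: ltr_leD; first exact: certificate_lt.
  by apply: ler_sum => k _; apply: certificate_le.
by rewrite ltNge le_x.
Qed.

End Certificate.

Theorem theorem3p5 (R : realType) (m n p : nat) (hn : (2 <= n)%N)
  (A : 'M[R]_(m, n)) (hA : nontrivial_null_space A)
  (B : 'M[R]_(p, m)) (C : 'M[R]_(p, n)) (hC : C = B *m A)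
  (W : 'M[R]_n)
  (hW : W = diag_mx (\row_(i < n) l2norm (C *m unit_vec R i)))
  (xs : 'cV[R]_n)
  (hdisj : forall j k : 'I_n, j \in supp xs -> k \in supp xs -> j != k ->
     supp (C^T *m C *m unit_vec R j) :&: supp (C^T *m C *m unit_vec R k)
       = set0)
  (hpar : forall (l q : 'I_n) (c : R), l != q ->
     C *m unit_vec R l <> c *: (C *m unit_vec R q)) :
  unique
    (is_minimizer (fun x : 'cV[R]_n => l1norm (W *m x))
                  (fun x : 'cV[R]_n => A *m x = A *m xs))
    xs.
Proof.
pose c i := C *m unit_vec R i; pose w i := l2norm (c i).
(* Since [n] is at least 2 there is some [q] other than [i]; a zero column would be 0 times column
   [q]. *)
have c_neq0 i : c i != 0.
  have := hn; rewrite -[n]card_ord (cardD1 i) ltnS.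
  case/card_gt0P => q; rewrite !inE andbT eq_sym => ne_iq.
  by apply/eqP => ci0; apply: (hpar i q 0 ne_iq); rewrite scale0r.
have w_gt0 i : 0 < w i by apply: l2norm_gt0.
have dot_cc i : dot (c i) (c i) = w i ^+ 2 by rewrite l2norm_sqr.
have cs i j : i != j -> `|dot (c i) (c j)| < w i * w j.
  by move=> ne_ij; apply: cauchy_schwarz_strict => // a; apply: hpar.
(* Otherwise the row index [i] would lie in both supports. *)
have disj i j k : j \in supp xs -> k \in supp xs -> k != j ->
    dot (c i) (c j) != 0 -> dot (c i) (c k) = 0.
  move=> jJ kJ ne_kj ij_neq0; apply/eqP/negP => /negP ik_neq0.
  have /setP/(_ i) := hdisj k j kJ jJ ne_kj.
  by rewrite !inE !gramE ij_neq0 ik_neq0.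
pose y := \sum_(j in supp xs) (Num.sg (xs j 0) / w j) *: c j.
pose s i := dot (c i) y.
have sE i : s i = \sum_(j in supp xs) Num.sg (xs j 0) / w j * dot (c i) (c j).
  rewrite /s /y /dot; under eq_bigr => k _ do rewrite summxE mulr_sumr.
  rewrite exchange_big; apply: eq_bigr => j _; rewrite mulr_sumr.
  by apply: eq_bigr => k _; rewrite !mxE mulrCA.
have s_single i j : j \in supp xs -> dot (c i) (c j) != 0 ->
    s i = Num.sg (xs j 0) / w j * dot (c i) (c j).
  move=> jJ ij_neq0; rewrite sE; apply: (sum_single jJ) => k kJ ne_kj.
  by rewrite (disj i j k) ?mulr0.
have cc_neq0 i : dot (c i) (c i) != 0 by rewrite dot_cc expf_neq0 ?gt_eqF.
have s_on i : i \in supp xs -> s i = Num.sg (xs i 0) * w i.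
  move=> iJ; rewrite (s_single i i) // dot_cc expr2 mulrA divfK //.
  by rewrite gt_eqF.
have s_off i : i \notin supp xs -> `|s i| < w i.
  (* Either one term survives, of absolute value [|dot (c i) (c j)| / w j], with [j] distinct from
     [i] so that strict Cauchy-Schwarz applies, or [s i] is 0. *)
  move=> inJ; case: (pickP [pred j in supp xs | dot (c i) (c j) != 0]) => [j|no_j].
    move=> /andP[jJ ij_neq0]; rewrite (s_single i j) // !normrM normr_sg.
    have -> : xs j 0 != 0 by move: jJ; rewrite inE.
    rewrite mul1r normfV (gtr0_norm (w_gt0 j)) mulrC ltr_pdivrMr // cs //.
    by apply: contraNneq inJ => ->.
  rewrite sE big1 ?normr0 // => j jJ; have := no_j j.
  by rewrite /= jJ /= => /negbFE/eqP ->; rewrite mulr0.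
have Ch0 x : A *m x = A *m xs -> C *m (x - xs) = 0.
  by move=> Ax; rewrite hC -mulmxA mulmxBr Ax subrr mulmx0.
have dot0 (u : 'cV[R]_p) : dot 0 u = 0.
  by rewrite /dot big1 // => k _; rewrite mxE mul0r.
have s_orth x : A *m x = A *m xs -> \sum_i s i * (x i 0 - xs i 0) = 0.
  move=> /Ch0 Ch; transitivity (dot (C *m (x - xs)) y); last by rewrite Ch dot0.
  by rewrite dot_mulmx; apply: eq_bigr => i _; rewrite !mxE.
have w_ge0 i : 0 <= w i by rewrite ltW.
have l1E x : l1norm (W *m x) = \sum_i w i * `|x i 0|.
  rewrite hW l1norm_diag_mx => [|i]; last by rewrite mxE w_ge0.
  by apply: eq_bigr => i _; rewrite mxE.
split; first split=> // x Ax.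
  by rewrite !l1E; apply: (certificate_min w_ge0 s_on s_off); apply: s_orth.
(* Testing the minimality of [x] against [xs] gives the bound that confines [x] to the support. *)
move=> x [Ax x_min]; have := x_min xs erefl; rewrite !l1E => le_x.
have x_off := certificate_supp w_ge0 s_on s_off (s_orth x Ax) le_x.
apply/colP => i; case: (boolP (i \in supp xs)) => [iJ|inJ]; last first.
  by rewrite x_off //; move: inJ; rewrite inE negbK => /eqP.
(* Pairing [C *m (x - xs) = 0] with [c i] isolates coordinate [i]: other terms vanish by
   orthogonality on the support and by [x_off] outside it. *)
have := dot_mulmx C (x - xs) (c i); rewrite Ch0 // dot0 (bigD1 i) //= big1.
  move/esym/eqP; rewrite addr0 mulf_eq0 (negbTE (cc_neq0 i)) /= !mxE subr_eq0.
  by move/eqP.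
move=> j ne_ji; case: (boolP (j \in supp xs)) => [jJ|jnJ].
  (* Row [j] itself is the test index: [dot (c j) (c j)] is nonzero, so [dot (c j) (c i)] must
     vanish. *)
  by rewrite -/(c j) (disj j j i) ?mul0r // eq_sym.
have xj0 := x_off j jnJ; move: jnJ; rewrite inE negbK => /eqP xsj0.
by rewrite !mxE xj0 xsj0 subrr mulr0.
Qed.
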